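(* Let $\{S_i\}_{i=1}^m$ be an IFS of similitudes $S_i(x)=rR_ix+d_i$ on $\mathbb R^d$ with common ratio $r\in(0,1)$, and let $(X,\mathcal E)$ be its augmented tree with respect to a bounded closed invariant set $J$. If $(X,\mathcal E)$ is simple, then it is hyperbolic.
   Context: IFS: $S_i(x)=rR_ix+d_i$, $0<r<1$, $R_i$ orthogonal, $d_i\in\mathbb R^d$. $\Sigma=\{1,\dots,m\}$, $X=\bigcup_{n\ge0}\Sigma^n$, $\Sigma^0=\{o\}$ (empty word, root); $S_{\mathbf u}=S_{i_1}\circ\cdots\circ S_{i_n}$ for $\mathbf u=i_1\cdots i_n$. Augmented tree: $J\subset\mathbb R^d$ is a fixed nonempty bounded closed set with $S_i(J)\subset J$ for all $i$; $J_{\mathbf u}=S_{\mathbf u}(J)$. $\mathcal E=\mathcal E_v\cup\mathcal E_h$; $\mathcal E_v$: (vertical) edges joining $\mathbf u$ and $\mathbf ui$; $\mathcal E_h$ (horizontal edges): pairs $(\mathbf u,\mathbf v)$, $\mathbf u\ne\mathbf v$ in the same level $\Sigma^n$, with $J_{\mathbf u}\cap J_{\mathbf v}\ne\emptyset$. Hyperbolic: with graph distance $d(\cdot,\cdot)$, $|x|=d(o,x)$ and Gromov product $|x\wedge y|=\frac12(|x|+|y|-d(x,y))$, there is $\delta>0$ with $|x\wedge y|\ge\min\{|x\wedge z|,|z\wedge y|\}-\delta$ for all $x,y,z\in X$. Simple: a horizontal connected component is a maximal connected horizontal subgraph $T$ of some level $\Sigma^n$. $T\Sigma=\{\mathbf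 ui:\mathbf u\in T,i\in\Sigma\}$. $T\sim T'$ if there is a bijection $g:T\cup T\Sigma\to T'\cup T'\Sigma$ (as subgraphs of $X$) such that $g,g^{-1}$ preserve vertical and horizontal edges. $X$ is simple if there are finitely many equivalence classes of horizontal connected components. *)

(* Defs.v *)
From HB Require Import structures.
From mathcomp Require Import all_boot all_order all_algebra.
From mathcomp Require Import all_classical all_reals all_analysis.
Set Implicit Arguments.
Unset Strict Implicit.
Unset Printing Implicit Defensive.
Import Order.TTheory GRing.Theory Num.Theory.
Import numFieldNormedType.Exports.
Local Open Scope classical_set_scope.
Local Open Scope ring_scope.

(* A graph on V is given by its adjacency relation E : V -> V -> Prop, which is
   symmetric in all uses below. *)
Definition is_walk (V : Type) (E : V -> V -> Prop) (x : V) (p : seq V) (y : V) :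
    Prop :=
  path (fun a b => `[< E a b >]) x p /\ last x p = y.

Definition walk_lengths (V : Type) (E : V -> V -> Prop) (x y : V) : set nat :=
  [set n | exists2 p, is_walk E x p y & size p = n].

(* The default value 0, taken when no walk joins x to y, is never used for an
   augmented tree, which is connected through its vertical edges. *)
Definition graph_dist (V : Type) (E : V -> V -> Prop) (x y : V) : nat :=
  xget 0%N [set n | walk_lengths E x y n /\
                    forall k, walk_lengths E x y k -> (n <= k)%N].

Definition gromov_product (R : realType) (V : Type) (E : V -> V -> Prop)
    (o x y : V) : R :=
  ((graph_dist E o x)%:R + (graph_dist E o y)%:R - (graph_dist E x y)%:R) / 2.

Definition hyperbolic (R : realType) (V : Type) (E : V -> V -> Prop) (o : V) :
    Prop :=
  exists2 delta : R, 0 < delta & forall x y z : V,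
    Num.min (gromov_product R E o x z) (gromov_product R E o z y) - delta
      <= gromov_product R E o x y.

Definition orthogonal_mx (R : realType) (d : nat) (Q : 'M[R]_d) : Prop :=
  Q *m Q^T = 1%:M.

Definition similitude (R : realType) (d : nat) (r : R) (Q : 'M[R]_d)
    (b x : 'cV[R]_d) : 'cV[R]_d :=
  r *: (Q *m x) + b.

(* The vertex set X, the union of all the Sigma^n, is the type of all finite
   words; Sigma^n consists of the words of size n and the root o is [::]. *)
Definition word (m : nat) := seq 'I_m.

Definition word_map (m : nat) (T : Type) (S : 'I_m -> T -> T) (u : word m) :
    T -> T :=
  foldr (fun i f => S i \o f) idfun u.

Definition word_cell (m : nat) (T : Type) (S : 'I_m -> T -> T) (J : set T)
    (u : word m) : set T :=
  word_map S u @` J.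

Definition vedge (m : nat) (u v : word m) : Prop :=
  exists i : 'I_m, v = rcons u i \/ u = rcons v i.

Definition hedge (m : nat) (T : Type) (S : 'I_m -> T -> T) (J : set T)
    (u v : word m) : Prop :=
  [/\ u <> v, size u = size v &
      word_cell S J u `&` word_cell S J v !=set0].

Definition aug_edge (m : nat) (T : Type) (S : 'I_m -> T -> T) (J : set T)
    (u v : word m) : Prop :=
  vedge u v \/ hedge S J u v.

Definition hconnected (m : nat) (T : Type) (S : 'I_m -> T -> T) (J : set T)
    (A : set (word m)) : Prop :=
  A !=set0 /\
  forall u v, A u -> A v ->
    exists2 p, is_walk (hedge S J) u p v & forall w, w \in p -> A w.

Definition level (m n : nat) : set (word m) := [set u | size u = n].

Definition hcomponent (m : nat) (T : Type) (S : 'I_m -> T -> T) (J : set T)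
    (A : set (word m)) : Prop :=
  exists n : nat, [/\ A `<=` level n, hconnected S J A &
    forall B : set (word m), B `<=` level n -> hconnected S J B ->
      A `<=` B -> B = A].

Definition children (m : nat) (A : set (word m)) : set (word m) :=
  [set w | exists2 u, A u & exists i : 'I_m, w = rcons u i].

(* Only the values of g on A `|` children A matter. *)
Definition hequiv (m : nat) (T : Type) (S : 'I_m -> T -> T) (J : set T)
    (A B : set (word m)) : Prop :=
  exists g : word m -> word m,
    set_bij (A `|` children A) (B `|` children B) g /\
    forall u v, (A `|` children A) u -> (A `|` children A) v ->
      (vedge u v <-> vedge (g u) (g v)) /\
      (hedge S J u v <-> hedge S J (g u) (g v)).

Definition hequiv_class (m : nat) (T : Type) (S : 'I_m -> T -> T) (J : set T)
    (A : set (word m)) : set (set (word m)) :=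
  [set B | hcomponent S J B /\ hequiv S J A B].

Definition simple_aug_tree (m : nat) (T : Type) (S : 'I_m -> T -> T)
    (J : set T) : Prop :=
  finite_set [set hequiv_class S J A | A in hcomponent S J].

(* Main.v *)
Require Import Defs.
From HB Require Import structures.
From mathcomp Require Import all_boot all_order all_algebra.
From mathcomp Require Import all_classical all_reals all_analysis.
From mathcomp Require Import zify lra.
Set Implicit Arguments.
Unset Strict Implicit.
Unset Printing Implicit Defensive.
Import Order.TTheory GRing.Theory Num.Theory.
Import numFieldNormedType.Exports.
Local Open Scope classical_set_scope.
Local Open Scope ring_scope.

(** The augmented tree is, up to a bounded error, the tree of its horizontal
    components, and a tree is 0-hyperbolic.

    Since the cells decrease along the tree, the ancestors of two horizontally
    connected words of a level are again horizontally connected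
    ([hjoined_take]).  Hence being joined at level k, meaning that the prefixes
    of length k lie in one component, is a decreasing property of k.

    A walk from x to y of length n forces x and y to be joined at some level k
    with |x| + |y| <= 2k + n ([joined_level_of_walk]); taking a geodesic gives
    |x /\ y| <= k.  Conversely, words joined at level k are linked by climbing
    from x to level k, crossing the component and descending to y, so that
    |x /\ y| >= k - K/2 once every two words of a component are linked by a
    horizontal walk of length at most K ([graph_dist_le_joined]).  As being
    joined at a given level is transitive, these two bounds give the hyperbolic
    inequality with any constant above K/2.

    Such a K exists in a simple tree: equivalent components T and T' have a
    bijection between the finite sets T u TSigma and T' u T'Sigma, so finitely
    many classes leave finitely many possible sizes ([hcomponent_size_bounded]),
    and a walk without repetition is no longer than its component is large. *)

(** * Walks and the graph distance *)

Lemma is_walk_cat (V : Type) (E : V -> V -> Prop) (x y z : V) (p q : seq V) :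
  is_walk E x p y -> is_walk E y q z -> is_walk E x (p ++ q) z.
Proof.
by move=> [pp <-] [pq <-]; split; rewrite ?last_cat // cat_path pp pq.
Qed.

Lemma is_walk_rev (V : Type) (E : V -> V -> Prop) (x y : V) (p : seq V) :
  (forall a b, E a b -> E b a) -> is_walk E x p y ->
  exists2 q, is_walk E y q x & size q = size p.
Proof.
move=> Esym [pp <-]; exists (rev (belast x p)); last first.
  by rewrite size_rev size_belast.
split; last by case: p {pp} => //= a p; rewrite rev_cons last_rcons.
rewrite rev_path; apply: sub_path pp => a b /asboolP Eab.
by apply/asboolP/Esym.
Qed.

Lemma is_walk_mono (V : Type) (E E' : V -> V -> Prop) (x y : V) (p : seq V) :
  (forall a b, E a b -> E' a b) -> is_walk E x p y -> is_walk E' x p y.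
Proof.
move=> EE' [pp <-]; split=> //; apply: sub_path pp => a b /asboolP Eab.
by apply/asboolP/EE'.
Qed.

Lemma is_walk_prefix (V : eqType) (E : V -> V -> Prop) (x y z : V) (p : seq V) :
  is_walk E x p y -> z \in p -> exists q, is_walk E x q z.
Proof.
move=> [+ _] zp; case/path.splitP: zp => p1 p2.
rewrite cat_path => /andP[pp1 _]; exists (rcons p1 z).
by split=> //; rewrite last_rcons.
Qed.

Lemma graph_distP (V : Type) (E : V -> V -> Prop) (x y : V) (p : seq V) :
  is_walk E x p y ->
  walk_lengths E x y (graph_dist E x y) /\
  forall k, walk_lengths E x y k -> (graph_dist E x y <= k)%N.
Proof.
move=> walk_p.
have ex_len : exists n, `[< walk_lengths E x y n >].
  by exists (size p); apply/asboolP; exists p.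
case: (ex_minnP ex_len) => n /asboolP len_n min_n.
rewrite /graph_dist; case: xgetP => [k _ //|/(_ n) []].
by split=> // k len_k; apply/min_n/asboolP.
Qed.

Lemma graph_dist_le (V : Type) (E : V -> V -> Prop) (x y : V) (p : seq V) :
  is_walk E x p y -> (graph_dist E x y <= size p)%N.
Proof. by move=> walk_p; apply: (proj2 (graph_distP walk_p)); exists p. Qed.

Lemma ex_geodesic (V : Type) (E : V -> V -> Prop) (x y : V) (p : seq V) :
  is_walk E x p y -> exists2 q, is_walk E x q y & size q = graph_dist E x y.
Proof. by move=> walk_p; case: (graph_distP walk_p). Qed.

(** * Horizontal connectedness *)

Definition hjoined (m : nat) (T : Type) (S : 'I_m -> T -> T) (J : set T)
    (u v : word m) : Prop :=
  exists p, is_walk (hedge S J) u p v.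

Lemma vedge_sym (m : nat) (u v : word m) : vedge u v -> vedge v u.
Proof. by move=> [i [] ->]; exists i; [right | left]. Qed.

Lemma hedge_sym (m : nat) (T : Type) (S : 'I_m -> T -> T) (J : set T)
  (u v : word m) : hedge S J u v -> hedge S J v u.
Proof. by move=> [uv suv cuv]; split; [exact/nesym | | rewrite setIC]. Qed.

Lemma aug_edge_sym (m : nat) (T : Type) (S : 'I_m -> T -> T) (J : set T)
  (u v : word m) : aug_edge S J u v -> aug_edge S J v u.
Proof. by move=> [/vedge_sym|/hedge_sym]; [left | right]. Qed.

Lemma hjoined_refl (m : nat) (T : Type) (S : 'I_m -> T -> T) (J : set T)
  (u : word m) : hjoined S J u u.
Proof. by exists [::]. Qed.

Lemma hjoined_sym (m : nat) (T : Type) (S : 'I_m -> T -> T) (J : set T)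
  (u v : word m) : hjoined S J u v -> hjoined S J v u.
Proof.
by move=> [p /(is_walk_rev (@hedge_sym _ _ S J))[q walk_q _]]; exists q.
Qed.

Lemma hjoined_trans (m : nat) (T : Type) (S : 'I_m -> T -> T) (J : set T)
  (u v w : word m) : hjoined S J u v -> hjoined S J v w -> hjoined S J u w.
Proof. by move=> [p wp] [q wq]; exists (p ++ q); exact: is_walk_cat wq. Qed.

Lemma hedge_hjoined (m : nat) (T : Type) (S : 'I_m -> T -> T) (J : set T)
  (u v : word m) : hedge S J u v -> hjoined S J u v.
Proof.
by move=> uv; exists [:: v]; split=> //=; rewrite andbT; apply/asboolP.
Qed.

(** Reduces a property of horizontally connected words to adjacent ones, with
    no walk left to handle. *)
Lemma hjoined_ind (m : nat) (T : Type) (S : 'I_m -> T -> T) (J : set T)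
  (P : word m -> word m -> Prop) :
  (forall u, P u u) -> (forall u v w, P u v -> P v w -> P u w) ->
  (forall u v, hedge S J u v -> P u v) ->
  forall u v, hjoined S J u v -> P u v.
Proof.
move=> Prefl Ptrans Pedge u v [p].
elim: p u => [|w p IHp] u [/= pp pl]; first by rewrite -pl.
move: pp => /andP[/asboolP uw pp].
by apply: Ptrans (Pedge _ _ uw) _; apply: IHp.
Qed.

Lemma hjoined_size (m : nat) (T : Type) (S : 'I_m -> T -> T) (J : set T)
  (u v : word m) : hjoined S J u v -> size u = size v.
Proof.
apply: (@hjoined_ind _ _ _ _ (fun u v : word m => size u = size v)) => //.
- by move=> ? ? ? ->.
- by move=> ? ? [].
Qed.

Lemma word_cell_cat (m : nat) (T : Type) (S : 'I_m -> T -> T) (J : set T)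
  (J_inv : forall i, S i @` J `<=` J) (u v : word m) :
  word_cell S J (u ++ v) `<=` word_cell S J u.
Proof.
have Jv : forall x, J x -> J (word_map S v x).
  by elim: v => [|i v IHv] x Jx //=; apply: (J_inv i); exists (word_map S v x);
     [exact: IHv|].
move=> _ [x Jx <-]; exists (word_map S v x); first exact: Jv.
by elim: u => //= i u ->.
Qed.

(** Prefixes of adjacent words have larger cells, which therefore still meet;
    the prefixes are adjacent unless they coincide. *)
Lemma hjoined_take (m : nat) (T : Type) (S : 'I_m -> T -> T) (J : set T)
  (J_inv : forall i, S i @` J `<=` J) (k : nat) (u v : word m) :
  hjoined S J u v -> hjoined S J (take k u) (take k v).
Proof.
apply: (@hjoined_ind _ _ S J (fun u v => hjoined S J (take k u) (take k v))).
- by move=> w; exact: hjoined_refl.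
- by move=> w1 w2 w3; exact: hjoined_trans.
move=> {}u {}v [_ suv [x [ux vx]]].
have [->|/eqP tuv] := eqVneq (take k u) (take k v); first exact: hjoined_refl.
apply: hedge_hjoined; split=> //; first by rewrite !size_take suv.
exists x; split.
- by apply: (word_cell_cat J_inv (v := drop k u)); rewrite cat_take_drop.
- by apply: (word_cell_cat J_inv (v := drop k v)); rewrite cat_take_drop.
Qed.

Lemma hjoined_take_le (m : nat) (T : Type) (S : 'I_m -> T -> T) (J : set T)
  (J_inv : forall i, S i @` J `<=` J) (j k : nat) (u v : word m) :
  (j <= k)%N -> hjoined S J (take k u) (take k v) ->
  hjoined S J (take j u) (take j v).
Proof. by move=> jk /(hjoined_take J_inv j); rewrite !take_takel. Qed.

(** * Horizontal components of a simple tree *)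

Lemma hcomponent_hjoined (m : nat) (T : Type) (S : 'I_m -> T -> T) (J : set T)
  (u : word m) : hcomponent S J (hjoined S J u).
Proof.
exists (size u); split; first by move=> v /hjoined_size.
- split; first by exists u; exact: hjoined_refl.
  move=> v w uv uw; have [p walk_p] := hjoined_trans (hjoined_sym uv) uw.
  exists p => // x xp; apply: hjoined_trans uv _.
  exact: is_walk_prefix walk_p xp.
- move=> B _ [_ Bconn] uB; apply/seteqP; split=> // v Bv.
  have [|p walk_p _] := Bconn u v _ Bv; last by exists p.
  by apply: uB; exact: hjoined_refl.
Qed.

Lemma finite_level (m n : nat) : finite_set (@level m n).
Proof.
have -> : @level m n = (fun t : n.-tuple 'I_m => t : word m) @` setT.
  apply/seteqP; split=> [u un|_ [t _ <-]]; last exact: size_tuple.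
  by exists (Tuple (introT eqP un)).
exact/finite_image/finite_finset.
Qed.

Lemma finite_hcomponent_children (m : nat) (T : Type) (S : 'I_m -> T -> T)
  (J : set T) (A : set (word m)) :
  hcomponent S J A -> finite_set (A `|` children A).
Proof.
move=> [n [An _ _]].
apply: (@sub_finite_set _ _ (@level m n `|` @level m n.+1)); last first.
  by rewrite finite_setU; split; exact: finite_level.
apply: setUSS => // _ [u Au [i ->]].
by rewrite /level /= size_rcons (An u Au).
Qed.

Lemma hequiv_refl (m : nat) (T : Type) (S : 'I_m -> T -> T) (J : set T)
  (A : set (word m)) : hequiv S J A A.
Proof. by exists id; split=> //; split=> // u Au; exists u. Qed.

(** An equivalence maps the finite set formed by A and its children onto the
    one formed by B, so the size of the former bounds B.  The bound is on
    duplicate-free lists, the form in which it applies to walks. *)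
Lemma hequiv_size_bounded (m : nat) (T : Type) (S : 'I_m -> T -> T)
  (J : set T) (A : set (word m)) :
  hcomponent S J A ->
  exists K, forall B s, hequiv S J A B -> uniq s -> {subset s <= B} ->
    (size s <= K)%N.
Proof.
move=> /finite_hcomponent_children/finite_seqP[t tE].
exists (size t) => B s [g [[_ _ gsurj] _]] s_uniq sB.
rewrite -(size_map g t); apply: uniq_leq_size => // w /sB; rewrite inE => Bw.
have [|v + <-] := gsurj w; first by left.
by rewrite tE => tv; exact: map_f.
Qed.

Lemma hcomponent_size_bounded (m : nat) (T : Type) (S : 'I_m -> T -> T)
  (J : set T) :
  simple_aug_tree S J ->
  exists K, forall A s, hcomponent S J A -> uniq s -> {subset s <= A} ->
    (size s <= K)%N.
Proof.
move=> /finite_seqP[cs csE].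
have bound C : exists K, C \in cs ->
    forall B s, C B -> uniq s -> {subset s <= B} -> (size s <= K)%N.
  have [Ccs|//] := boolP (C \in cs); last by exists 0%N.
  have : [set` cs] C by [].
  rewrite -csE => -[A compA <-].
  have [K HK] := hequiv_size_bounded compA.
  by exists K => _ B s [_ AB]; exact: HK.
have [K HK] := choice bound.
exists (\max_(C <- cs) K C)%N => A s compA s_uniq sA.
have Acs : hequiv_class S J A \in cs.
  suff : [set` cs] (hequiv_class S J A) by [].
  by rewrite -csE; exists A.
apply: leq_trans (leq_bigmax_seq (F := K) _ Acs isT).
apply: (HK _ Acs A) => //; split=> //; exact: hequiv_refl.
Qed.

Lemma hjoined_short_walk (m : nat) (T : Type) (S : 'I_m -> T -> T) (J : set T) :
  simple_aug_tree S J ->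
  exists K, forall u v, hjoined S J u v ->
    exists2 p, is_walk (hedge S J) u p v & (size p <= K)%N.
Proof.
move=> /hcomponent_size_bounded[K HK]; exists K => u v [p [pp <-]].
case/shortenP: pp => q pq q_uniq _; exists q => //.
apply: (HK (hjoined S J u)) => [||w wq]; first exact: hcomponent_hjoined.
  by case/andP: q_uniq.
by rewrite inE; apply: is_walk_prefix wq; split.
Qed.

(** * Distances in the augmented tree *)

Lemma ex_descending_walk (m : nat) (T : Type) (S : 'I_m -> T -> T) (J : set T)
  (u v : word m) :
  exists2 p, is_walk (aug_edge S J) u p (u ++ v) & size p = size v.
Proof.
elim: v u => [|i v IHv] u; first by exists [::] => //; rewrite cats0.
have [p [pp pl] sp] := IHv (rcons u i).
exists (rcons u i :: p); last by rewrite /= sp.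
split; last by rewrite /= pl cat_rcons.
by rewrite /= pp andbT; apply/asboolP; left; exists i; left.
Qed.

(** Climb from x to its prefix of length k, cross, and descend to y.  With
    k = 0 this also shows that the graph is connected. *)
Lemma ex_walk_across (m : nat) (T : Type) (S : 'I_m -> T -> T) (J : set T)
  (x y : word m) (k : nat) (p : seq (word m)) :
  is_walk (hedge S J) (take k x) p (take k y) ->
  exists2 q, is_walk (aug_edge S J) x q y &
    size q = (size x - k + (size p + (size y - k)))%N.
Proof.
move=> /(is_walk_mono (E' := aug_edge S J)) walk_p.
have [q1 + sq1] := ex_descending_walk S J (take k x) (drop k x).
move=> /(is_walk_rev (@aug_edge_sym _ _ S J))[q1' + sq1'].
have [q2 + sq2] := ex_descending_walk S J (take k y) (drop k y).
rewrite !cat_take_drop => walk_q2 walk_q1; exists (q1' ++ (p ++ q2)).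
  apply: is_walk_cat walk_q1 _; apply: is_walk_cat walk_q2.
  by apply: walk_p => a b; right.
by rewrite !size_cat sq1' sq1 sq2 !size_drop.
Qed.

Lemma ex_walk (m : nat) (T : Type) (S : 'I_m -> T -> T) (J : set T)
  (x y : word m) : exists p, is_walk (aug_edge S J) x p y.
Proof.
have [|q walk_q _] := @ex_walk_across _ _ S J x y 0 [::]; last by exists q.
by rewrite !take0.
Qed.

(** Extend the walk backwards, from its end y to its start x.  At y itself
    k = |y| works.  A horizontal step or a step to a child keeps k, and |x|
    grows by at most one.  A step to the parent keeps k as well, unless the
    child has length k: then k has to drop by one together with |x|.  In every
    case |x| + |y| - 2k grows by at most the one unit that the walk gains. *)
Lemma joined_level_of_walk (m : nat) (T : Type) (S : 'I_m -> T -> T)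
  (J : set T) (J_inv : forall i, S i @` J `<=` J) (x y : word m)
  (p : seq (word m)) :
  is_walk (aug_edge S J) x p y ->
  exists k, [/\ (k <= size x)%N, (k <= size y)%N,
    (size x + size y <= 2 * k + size p)%N &
    hjoined S J (take k x) (take k y)].
Proof.
elim: p x => [|w p IHp] x.
  move=> [_ /= <-]; exists (size x); split=> //; first lia.
  exact: hjoined_refl.
move=> [/= /andP[/asboolP xw pp] pl].
have [k [kw ky kwy jwy]] := IHp w (conj pp pl).
case: xw => [[i [wE|xE]]|xw].
- subst w; rewrite size_rcons in kw kwy.
  have [kx|xk] := leqP k (size x).
    exists k; split=> //; first lia.
    by move: jwy; rewrite -cats1 takel_cat.
  exists (size x); split=> //; try lia.
  have := hjoined_take_le J_inv (ltnW xk) jwy.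
  by rewrite -cats1 takel_cat.
- subst x; exists k; rewrite size_rcons; split=> //; try lia.
  by rewrite -cats1 takel_cat.
- have sxw : size x = size w by case: xw.
  exists k; rewrite sxw; split=> //; first lia.
  apply: hjoined_trans jwy; apply: hjoined_take => //; exact: hedge_hjoined.
Qed.

Lemma joined_level_of_dist (m : nat) (T : Type) (S : 'I_m -> T -> T)
  (J : set T) (J_inv : forall i, S i @` J `<=` J) (x y : word m) :
  exists k, [/\ (k <= size x)%N, (k <= size y)%N,
    (size x + size y <= 2 * k + graph_dist (aug_edge S J) x y)%N &
    hjoined S J (take k x) (take k y)].
Proof.
have [p walk_p] := ex_walk S J x y.
have [q walk_q <-] := ex_geodesic walk_p.
exact: (joined_level_of_walk J_inv walk_q).
Qed.

Lemma graph_dist_root (m : nat) (T : Type) (S : 'I_m -> T -> T)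
  (J : set T) (J_inv : forall i, S i @` J `<=` J) (x : word m) :
  graph_dist (aug_edge S J) [::] x = size x.
Proof.
apply/eqP; rewrite eqn_leq; apply/andP; split.
  have [p walk_p <-] := ex_descending_walk S J [::] x.
  exact: graph_dist_le walk_p.
have [k [/= k0 _ + _]] := joined_level_of_dist J_inv [::] x.
by move: k0; rewrite leqn0 => /eqP ->.
Qed.

Lemma graph_dist_le_joined (m : nat) (T : Type) (S : 'I_m -> T -> T)
  (J : set T) : simple_aug_tree S J ->
  exists K, forall (k : nat) (x y : word m),
    (k <= size x)%N -> (k <= size y)%N ->
    hjoined S J (take k x) (take k y) ->
    (2 * k + graph_dist (aug_edge S J) x y <= size x + size y + K)%N.
Proof.
move=> /hjoined_short_walk[K HK]; exists K => k x y kx ky /HK[p + pK].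
move=> /ex_walk_across[q walk_q sq].
by have := graph_dist_le walk_q; lia.
Qed.

Theorem proposition3p4 (R : realType) (d m : nat) (r : R)
    (Q : 'I_m -> 'M[R]_d) (b : 'I_m -> 'cV[R]_d)
    (S : 'I_m -> 'cV[R]_d -> 'cV[R]_d) (J : set 'cV[R]_d)
    (hr : 0 < r < 1)
    (hQ : forall i, orthogonal_mx (Q i))
    (hS : forall i x, S i x = similitude r (Q i) (b i) x)
    (J_neq0 : J !=set0) (J_bounded : bounded_set J) (J_closed : closed J)
    (J_inv : forall i, S i @` J `<=` J) :
  simple_aug_tree S J -> hyperbolic R (aug_edge S J) [::].
Proof.
move=> /graph_dist_le_joined[K HK].
exists (K%:R + 1); first exact: ltr_wpDl.
move=> x y z; rewrite /gromov_product !(graph_dist_root J_inv).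
have [k1 [k1x k1z dxz jxz]] := joined_level_of_dist J_inv x z.
have [k2 [k2z k2y dzy jzy]] := joined_level_of_dist J_inv z y.
(* Joining persists downwards, so at the smaller level x is joined to y
   through z. *)
have [k [kk1 kk2 kE]] : exists k, [/\ k <= k1, k <= k2 & k = k1 \/ k = k2]%N.
  by exists (minn k1 k2); split; lia.
have dxy : (2 * k + graph_dist (aug_edge S J) x y <= size x + size y + K)%N.
  apply: HK; [lia | lia |].
  apply: hjoined_trans (hjoined_take_le J_inv kk1 jxz) _.
  exact: (hjoined_take_le J_inv kk2 jzy).
move: dxy dxz dzy; rewrite -!(ler_nat R) !(natrM, natrD).
have K_ge0 : (0 : R) <= K%:R by [].
rewrite lerBlDr ge_min => dxy dxz dzy.
by case: kE => kE; subst k; apply/orP; [left | right]; lra.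
Qed.
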